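(* A ring $A$ is perinormal if and only if $A_{(M)}$ is perinormal for each maximal ideal $M$ of $A$.
   Context: All rings are commutative with unity. For a ring $A$, $\mathrm{Reg}(A)$ is the set of regular elements (non-zero-divisors) of $A$, and the total quotient ring $K$ of $A$ is the fraction ring of $A$ with denominators in $\mathrm{Reg}(A)$. An overring of $A$ is a ring $B$ with $A\subseteq B\subseteq K$. A ring extension $A\subseteq B$ satisfies going down if, whenever $P_1\subseteq P_2$ are prime ideals of $A$ and $Q_2$ is a prime ideal of $B$ with $Q_2\cap A=P_2$, there is a prime ideal $Q_1\subseteq Q_2$ of $B$ with $Q_1\cap A=P_1$. A GD-overring of $A$ is an overring $B$ of $A$ such that $A\subseteq B$ satisfies going down. A ring $A$ is perinormal if every GD-overring of $A$ is flat as an $A$-module. For a prime ideal $P$ of $A$, the regular quotient ring $A_{(P)}$ is the fraction ring of $A$ with denominators in $(A-P)\cap \mathrm{Reg}(A)$; it is an overring of $A$. *)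

(* Defs.v *)
(* Rings are [comPzRingType]s, so that the zero ring is not
   excluded.  Subsets are collective predicates; since [boolp] makes every
   proposition decidable, this loses no subset. *)
From HB Require Import structures.
From mathcomp Require Import all_boot all_algebra.
From mathcomp Require Import boolp.
From mathcomp Require Import ring.

Set Implicit Arguments.
Unset Strict Implicit.
Unset Printing Implicit Defensive.

Import GRing.Theory.
Local Open Scope ring_scope.
Local Open Scope quotient_scope.

Section Ideals.
Variable R : comPzRingType.
Implicit Types I J P M : {pred R}.

(* The ideal notions of [ring_quotient] are restricted to nonzero rings. *)
Definition is_ideal I : Prop :=
  0 \in I /\ forall a, {in I &, forall u v, a * u + v \in I}.

Definition prime_ideal P : Prop :=
  [/\ is_ideal P, 1 \notin P &
      forall u v, u * v \in P -> (u \in P) || (v \in P)].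

Definition maximal_ideal M : Prop :=
  [/\ is_ideal M, 1 \notin M &
      forall J, is_ideal J -> 1 \notin J -> {subset M <= J} -> {subset J <= M}].

Lemma maximal_prime M : maximal_ideal M -> prime_ideal M.
Proof.
move=> [[M0 Ml] M1 Mmax]; split=> // u v uvM.
have [//|uM /=] := boolP (u \in M); apply: contraT => vM.
have idJ w : is_ideal (fun x : R => `[< exists a, x - a * w \in M >]).
  split=> [|c x y /asboolP[a xa] /asboolP[b yb]]; apply/asboolP.
    by exists 0; rewrite mul0r subr0.
  exists (c * a + b).
  have -> : c * x + y - (c * a + b) * w = c * (x - a * w) + (y - b * w) by ring.
  exact: Ml.
have inJ w : w \notin M -> exists a, 1 - a * w \in M.
  move=> wM; pose J : {pred R} := fun x : R => `[< exists a, x - a * w \in M >].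
  have MJ : {subset M <= J}.
    by move=> x xM; apply/asboolP; exists 0; rewrite mul0r subr0.
  have [/asboolP//|J1] := boolP (1 \in J).
  case/negP: wM; apply: (Mmax J) => //; first exact: idJ.
  by apply/asboolP; exists 1; rewrite mul1r subrr.
have [a ua] := inJ u uM; have [b vb] := inJ v vM.
case/negP: M1.
have -> : 1 = (b * v) * (1 - a * u) + ((a * b) * (u * v) + (1 - b * v)) by ring.
by apply/Ml/Ml.
Qed.

End Ideals.

Section Multiplicative.
Variable A : comPzRingType.

Definition Reg : {pred A} := fun x => `[< forall y, x * y = 0 -> y = 0 >].

Lemma Reg_mulr_closed : mulr_closed Reg.
Proof.
split=> [|x y /asboolP xR /asboolP yR]; apply/asboolP => z.
  by rewrite mul1r.
by rewrite -mulrA => /xR/yR.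
Qed.
HB.instance Definition _ := GRing.isMulClosed.Build A Reg Reg_mulr_closed.

Definition Reg_compl (P : {pred A}) (hP : prime_ideal P) : {pred A} :=
  fun x => (x \notin P) && (x \in Reg).

Lemma Reg_compl_mulr_closed (P : {pred A}) (hP : prime_ideal P) :
  mulr_closed (Reg_compl hP).
Proof.
have [ _ P1 Pm] := hP; split=> [|x y /andP[xP xR] /andP[yP yR]]; apply/andP.
  by rewrite rpred1.
split; last exact: rpredM.
by apply/negP => /Pm; rewrite (negPf xP) (negPf yP).
Qed.
HB.instance Definition _ (P : {pred A}) (hP : prime_ideal P) :=
  GRing.isMulClosed.Build A (Reg_compl hP) (Reg_compl_mulr_closed hP).

End Multiplicative.

Section FractionRing.
Variables (A : comPzRingType) (S : mulrClosed A).

Definition denom := {s : A | s \in S}.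
Definition mkdenom (s : A) (hs : s \in S) : denom := exist _ s hs.
Definition denom1 : denom := mkdenom (rpred1 S).
Definition denomM (s t : denom) : denom :=
  mkdenom (rpredM (valP s) (valP t)).

Definition frac_equiv (x y : A * denom) : bool :=
  `[< exists2 u, u \in S & u * (x.1 * val y.2) = u * (y.1 * val x.2) >].

Lemma frac_equiv_refl : reflexive frac_equiv.
Proof. by move=> x; apply/asboolP; exists 1; rewrite ?rpred1. Qed.

Lemma frac_equiv_sym : symmetric frac_equiv.
Proof.
by move=> x y; apply/asboolP/asboolP => -[u uS e]; exists u.
Qed.

Lemma frac_equiv_trans : transitive frac_equiv.
Proof.
move=> [b t] [a s] [c r] /asboolP[u uS /= e] /asboolP[v vS /= f].
apply/asboolP; exists (u * v * val t) => /=.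
  by rewrite !rpredM // (valP t).
have -> : u * v * val t * (a * val r) = (v * val r) * (u * (a * val t)) by ring.
rewrite e.
have -> : v * val r * (u * (b * val s)) = (u * val s) * (v * (b * val r)) by ring.
by rewrite f /=; ring.
Qed.

Canonical frac_equiv_equiv :=
  EquivRel frac_equiv frac_equiv_refl frac_equiv_sym frac_equiv_trans.

Definition fracring := {eq_quot frac_equiv}.
HB.instance Definition _ := EqQuotient.on fracring.
HB.instance Definition _ := Choice.on fracring.

Definition frac (a : A) (s : denom) : fracring := \pi_fracring (a, s).

Lemma fracP (x : fracring) : exists a s, x = frac a s.
Proof. by elim/quotW: x => -[a s]; exists a, s. Qed.

Lemma eq_fracP a s b t : frac a s = frac b t <->
  exists2 u, u \in S & u * (a * val t) = u * (b * val s).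
Proof.
by rewrite /frac; split=> [/eqmodP/asboolP //|h]; apply/eqmodP/asboolP.
Qed.

Let num (x : fracring) : A := (repr x).1.
Let den (x : fracring) : denom := (repr x).2.
Let numdenK x : frac (num x) (den x) = x.
Proof. by rewrite /frac /num /den -surjective_pairing reprK. Qed.

Definition addf (x y : fracring) : fracring :=
  frac (num x * val (den y) + num y * val (den x)) (denomM (den x) (den y)).
Definition oppf (x : fracring) : fracring := frac (- num x) (den x).
Definition mulf (x y : fracring) : fracring :=
  frac (num x * num y) (denomM (den x) (den y)).

Lemma addfE a s b t :
  addf (frac a s) (frac b t) = frac (a * val t + b * val s) (denomM s t).
Proof.
rewrite /addf; move: (numdenK (frac a s)) (numdenK (frac b t)).
set a' := num _; set s' := den _; set b' := num _; set t' := den _.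
move=> /eq_fracP[u uS e] /eq_fracP[v vS f]; apply/eq_fracP.
exists (u * v) => /=; first exact: rpredM.
have -> : u * v * ((a' * val t' + b' * val s') * (val s * val t)) =
  (v * val t * val t') * (u * (a' * val s)) +
  (u * val s * val s') * (v * (b' * val t)) by ring.
by rewrite e f /=; ring.
Qed.

Lemma oppfE a s : oppf (frac a s) = frac (- a) s.
Proof.
rewrite /oppf; move: (numdenK (frac a s)).
set a' := num _; set s' := den _ => /eq_fracP[u uS e].
by apply/eq_fracP; exists u; rewrite // !mulNr !mulrN e.
Qed.

Lemma mulfE a s b t :
  mulf (frac a s) (frac b t) = frac (a * b) (denomM s t).
Proof.
rewrite /mulf; move: (numdenK (frac a s)) (numdenK (frac b t)).
set a' := num _; set s' := den _; set b' := num _; set t' := den _.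
move=> /eq_fracP[u uS e] /eq_fracP[v vS f]; apply/eq_fracP.
exists (u * v) => /=; first exact: rpredM.
have -> : u * v * (a' * b' * (val s * val t)) =
  (u * (a' * val s)) * (v * (b' * val t)) by ring.
by rewrite e f /=; ring.
Qed.

Let eqf a s b t : a * val t = b * val s -> frac a s = frac b t.
Proof. by move=> e; apply/eq_fracP; exists 1; rewrite ?rpred1 // e. Qed.

Let addfA : associative addf.
Proof.
move=> x y z; have [a [s ->]] := fracP x; have [b [t ->]] := fracP y.
have [c [r ->]] := fracP z; rewrite !addfE; apply: eqf => /=; ring.
Qed.

Let addfC : commutative addf.
Proof.
move=> x y; have [a [s ->]] := fracP x; have [b [t ->]] := fracP y.
by rewrite !addfE; apply: eqf => /=; ring.
Qed.

Let add0f : left_id (frac 0 denom1) addf.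
Proof.
move=> x; have [a [s ->]] := fracP x.
by rewrite !addfE; apply: eqf => /=; ring.
Qed.

Let addNf : left_inverse (frac 0 denom1) oppf addf.
Proof.
move=> x; have [a [s ->]] := fracP x.
by rewrite oppfE !addfE; apply: eqf => /=; ring.
Qed.

HB.instance Definition _ :=
  GRing.isZmodule.Build fracring addfA addfC add0f addNf.

Let mulfA : associative mulf.
Proof.
move=> x y z; have [a [s ->]] := fracP x; have [b [t ->]] := fracP y.
have [c [r ->]] := fracP z; rewrite !mulfE; apply: eqf => /=; ring.
Qed.

Let mulfC : commutative mulf.
Proof.
move=> x y; have [a [s ->]] := fracP x; have [b [t ->]] := fracP y.
by rewrite !mulfE; apply: eqf => /=; ring.
Qed.

Let mul1f : left_id (frac 1 denom1) mulf.
Proof.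
move=> x; have [a [s ->]] := fracP x.
by rewrite !mulfE; apply: eqf => /=; ring.
Qed.

Let mulfDl : left_distributive mulf addf.
Proof.
move=> x y z; have [a [s ->]] := fracP x; have [b [t ->]] := fracP y.
have [c [r ->]] := fracP z; rewrite !(mulfE, addfE); apply: eqf => /=; ring.
Qed.

HB.instance Definition _ :=
  GRing.Zmodule_isComPzRing.Build fracring mulfA mulfC mul1f mulfDl.

Definition tofracring (a : A) : fracring := frac a denom1.

Lemma tofracring_is_zmod_morphism : zmod_morphism tofracring.
Proof.
move=> a b; rewrite /tofracring -[RHS]/(addf _ (oppf _)) oppfE addfE.
by apply: eqf => /=; ring.
Qed.

Lemma tofracring_is_monoid_morphism : monoid_morphism tofracring.
Proof.
split=> // a b; rewrite /tofracring [RHS]mulfE; apply: eqf => /=; ring.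
Qed.

HB.instance Definition _ :=
  GRing.isZmodMorphism.Build A fracring tofracring tofracring_is_zmod_morphism.
HB.instance Definition _ :=
  GRing.isMonoidMorphism.Build A fracring tofracring
    tofracring_is_monoid_morphism.

Lemma tofracring_inj : {subset S <= @Reg A} -> injective tofracring.
Proof.
move=> SR a b /eq_fracP[u /SR/asboolP uR /=]; rewrite !mulr1 => e.
by apply/eqP; rewrite -subr_eq0; apply/eqP/uR; rewrite mulrBr e subrr.
Qed.

End FractionRing.

Definition total_quotient_ring (A : comPzRingType) : comPzRingType :=
  fracring (@Reg A).

(* A_(P) *)
Definition regular_quotient_ring (A : comPzRingType) (P : {pred A})
  (hP : prime_ideal P) : comPzRingType := fracring (Reg_compl hP).

Section Subring.
Variables (K : comPzRingType) (B : subringClosed K).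

Definition subring_sort := {x : K | x \in B}.

HB.instance Definition _ := SubChoice.on subring_sort.
HB.instance Definition _ :=
  GRing.SubChoice_isSubComPzRing.Build K (B : {pred K}) subring_sort
    (subringClosedP B).

End Subring.

(* [corestr hB] is f with codomain restricted to the subring B; it stands for
   the inclusion when f embeds A in K. *)
Section Corestriction.
Variables (A K : comPzRingType) (f : {rmorphism A -> K}) (B : subringClosed K).
Variable hB : forall a, f a \in B.

Definition corestr (a : A) : subring_sort B := exist _ (f a) (hB a).

Lemma corestr_is_zmod_morphism : zmod_morphism corestr.
Proof. by move=> a b; apply: val_inj; rewrite /= rmorphB. Qed.

Lemma corestr_is_monoid_morphism : monoid_morphism corestr.
Proof.
by split=> [|a b]; apply: val_inj; rewrite /= ?rmorph1 ?rmorphM.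
Qed.

HB.instance Definition _ :=
  GRing.isZmodMorphism.Build A (subring_sort B) corestr
    corestr_is_zmod_morphism.
HB.instance Definition _ :=
  GRing.isMonoidMorphism.Build A (subring_sort B) corestr
    corestr_is_monoid_morphism.

End Corestriction.

Definition going_down (A B : comPzRingType) (f : {rmorphism A -> B}) : Prop :=
  forall (P1 P2 : {pred A}) (Q2 : {pred B}),
    prime_ideal P1 -> prime_ideal P2 -> {subset P1 <= P2} ->
    prime_ideal Q2 -> [preim f of Q2] =i P2 ->
  exists Q1 : {pred B},
    [/\ prime_ideal Q1, {subset Q1 <= Q2} & [preim f of Q1] =i P1].

(* M (x)_A N is the set of formal sums of pairs (m, n), represented as
   sequences, modulo the congruence generated by the bilinearity relations.
   Formal inverses are not needed since -(m, n) is (- m, n). *)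
Section Tensor.
Variables (A : comPzRingType) (M N : lmodType A).

Inductive tensor_rel : seq (M * N) -> seq (M * N) -> Prop :=
| tensor_refl s : tensor_rel s s
| tensor_sym s t : tensor_rel s t -> tensor_rel t s
| tensor_trans s t r : tensor_rel s t -> tensor_rel t r -> tensor_rel s r
| tensor_cat s s' t t' :
    tensor_rel s s' -> tensor_rel t t' -> tensor_rel (s ++ t) (s' ++ t')
| tensor_catC s t : tensor_rel (s ++ t) (t ++ s)
| tensor_0l n : tensor_rel [:: (0, n)] [::]
| tensor_Dl m m' n : tensor_rel [:: (m + m', n)] [:: (m, n); (m', n)]
| tensor_Dr m n n' : tensor_rel [:: (m, n + n')] [:: (m, n); (m, n')]
| tensor_Z a m n : tensor_rel [:: (a *: m, n)] [:: (m, a *: n)].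

Definition tensor_equiv s t : bool := `[< tensor_rel s t >].

Lemma tensor_equiv_refl : reflexive tensor_equiv.
Proof. by move=> s; apply/asboolP/tensor_refl. Qed.

Lemma tensor_equiv_sym : symmetric tensor_equiv.
Proof. by move=> s t; apply/asboolP/asboolP => /tensor_sym. Qed.

Lemma tensor_equiv_trans : transitive tensor_equiv.
Proof.
by move=> t s r /asboolP st /asboolP tr; apply/asboolP/tensor_trans/tr.
Qed.

Canonical tensor_equiv_equiv :=
  EquivRel tensor_equiv tensor_equiv_refl tensor_equiv_sym tensor_equiv_trans.

Definition tensor := {eq_quot tensor_equiv}.
HB.instance Definition _ := EqQuotient.on tensor.
HB.instance Definition _ := Choice.on tensor.

Definition tens_sum (s : seq (M * N)) : tensor := \pi_tensor s.

Lemma tens_sumP s t : tens_sum s = tens_sum t <-> tensor_rel s t.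
Proof.
by rewrite /tens_sum; split=> [/eqmodP/asboolP //|h]; apply/eqmodP/asboolP.
Qed.

Let reprP s : tensor_rel (repr (tens_sum s)) s.
Proof. by apply/tens_sumP; rewrite /tens_sum reprK. Qed.

Let scales (a : A) (s : seq (M * N)) := [seq (a *: p.1, p.2) | p <- s].

Let scales_rel a s t : tensor_rel s t -> tensor_rel (scales a s) (scales a t).
Proof.
elim=> {s t} [s|s t _|s t r _ + _|s s' t t' _ + _|s t|n|m m' n|m n n'|b m n] /=.
- exact: tensor_refl.
- exact: tensor_sym.
- exact: tensor_trans.
- by rewrite /scales !map_cat; apply: tensor_cat.
- by rewrite /scales !map_cat; apply: tensor_catC.
- by rewrite scaler0; apply: tensor_0l.
- by rewrite scalerDr; apply: tensor_Dl.
- exact: tensor_Dr.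
- by rewrite scalerA mulrC -scalerA; apply: tensor_Z.
Qed.

Definition addt (x y : tensor) : tensor := tens_sum (repr x ++ repr y).
Definition scalet (a : A) (x : tensor) : tensor :=
  tens_sum [seq (a *: p.1, p.2) | p <- repr x].
Definition oppt : tensor -> tensor := scalet (-1).

Lemma addtE s t : addt (tens_sum s) (tens_sum t) = tens_sum (s ++ t).
Proof. by apply/tens_sumP/tensor_cat; apply: reprP. Qed.

Lemma scaletE a s :
  scalet a (tens_sum s) = tens_sum [seq (a *: p.1, p.2) | p <- s].
Proof. by apply/tens_sumP/scales_rel/reprP. Qed.

Let addtA : associative addt.
Proof.
elim/quotW=> s; elim/quotW=> t; elim/quotW=> r.
by rewrite -!/(tens_sum _) !addtE catA.
Qed.

Let addtC : commutative addt.
Proof.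
elim/quotW=> s; elim/quotW=> t.
by rewrite -!/(tens_sum _) !addtE; apply/tens_sumP/tensor_catC.
Qed.

Let add0t : left_id (tens_sum [::]) addt.
Proof. by elim/quotW=> s; rewrite -!/(tens_sum _) !addtE. Qed.

Let tens_sum_cons p s :
  tens_sum (p :: s) = addt (tens_sum [:: p]) (tens_sum s).
Proof. by rewrite addtE. Qed.

Let addtACA : interchange addt addt.
Proof.
move=> x y z t; rewrite -[LHS]addtA -[RHS]addtA; congr (addt x).
by rewrite [LHS]addtA [RHS]addtA [addt y z]addtC.
Qed.

Let scaletDl (x : tensor) (a b : A) :
  scalet (a + b) x = addt (scalet a x) (scalet b x).
Proof.
elim/quotW: x => s; rewrite -/(tens_sum _) !scaletE.
elim: s => [|[m n] s IHs]; first by rewrite add0t.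
rewrite /= [LHS]tens_sum_cons {}IHs.
rewrite [tens_sum ((a *: m, n) :: _)]tens_sum_cons.
rewrite [tens_sum ((b *: m, n) :: _)]tens_sum_cons.
have -> : tens_sum [:: ((a + b) *: m, n)] =
          addt (tens_sum [:: (a *: m, n)]) (tens_sum [:: (b *: m, n)]).
  by rewrite addtE scalerDl; apply/tens_sumP/tensor_Dl.
exact: addtACA.
Qed.

Let scale1t : left_id 1 scalet.
Proof.
elim/quotW=> s; rewrite -/(tens_sum _) scaletE; congr tens_sum.
by rewrite -[RHS]map_id; apply: eq_map => -[m n]; rewrite /= scale1r.
Qed.

Let scale0t (x : tensor) : scalet 0 x = tens_sum [::].
Proof.
elim/quotW: x => s; rewrite -/(tens_sum _) scaletE.
elim: s => [//|[m n] s IHs]; rewrite /= [LHS]tens_sum_cons {}IHs addtE cats0.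
by rewrite scale0r; apply/tens_sumP/tensor_0l.
Qed.

Let addNt : left_inverse (tens_sum [::]) oppt addt.
Proof.
by move=> x; rewrite -[X in addt _ X]scale1t -scaletDl addNr scale0t.
Qed.

HB.instance Definition _ :=
  GRing.isZmodule.Build tensor addtA addtC add0t addNt.

Let scaletA a b x : scalet a (scalet b x) = scalet (a * b) x.
Proof.
elim/quotW: x => s; rewrite -/(tens_sum _) !scaletE -map_comp.
by congr tens_sum; apply: eq_map => -[m n]; rewrite /= scalerA.
Qed.

Let scaletDr : right_distributive scalet addt.
Proof.
move=> a; elim/quotW=> s; elim/quotW=> t.
by rewrite -!/(tens_sum _) !(scaletE, addtE) map_cat.
Qed.

HB.instance Definition _ :=
  GRing.Zmodule_isLmodule.Build A tensor scaletA scale1t scaletDr scaletDl.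

Definition tens (m : M) (n : N) : tensor := tens_sum [:: (m, n)].

Lemma tens_sumE s : tens_sum s = \sum_(p <- s) tens p.1 p.2.
Proof.
elim: s => [|[m n] s IHs]; first by rewrite big_nil.
by rewrite big_cons -IHs tens_sum_cons.
Qed.

Lemma tensDl n : {morph tens^~ n : m m' / m + m'}.
Proof.
by move=> m m'; rewrite [RHS]addtE; apply/tens_sumP/tensor_Dl.
Qed.

Lemma tensDr m : {morph tens m : n n' / n + n'}.
Proof.
by move=> n n'; rewrite [RHS]addtE; apply/tens_sumP/tensor_Dr.
Qed.

Lemma tensZl a m n : tens (a *: m) n = a *: tens m n.
Proof. by rewrite [RHS]scaletE. Qed.

Lemma tensZr a m n : tens m (a *: n) = a *: tens m n.
Proof. by rewrite -tensZl; apply/esym/tens_sumP/tensor_Z. Qed.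

(* The universal property, on representatives. *)
Lemma tensor_rel_bilinear (G : lmodType A) (b : M -> N -> G) :
    (forall n, linear (b^~ n)) -> (forall m, linear (b m)) ->
  forall s t, tensor_rel s t ->
    \sum_(p <- s) b p.1 p.2 = \sum_(p <- t) b p.1 p.2.
Proof.
move=> bl br s t.
have b0l n : b 0 n = 0.
  by move: (bl n (-1) 0 0); rewrite scaler0 addr0 scaleN1r addNr.
have b0r m : b m 0 = 0.
  by move: (br m (-1) 0 0); rewrite scaler0 addr0 scaleN1r addNr.
elim=> {s t} [//|//|s t r _ -> _ -> //|s s' t t' _ + _|s t|n|m m' n|m n n'|a m n].
- by rewrite !big_cat /= => -> ->.
- by rewrite !big_cat /= addrC.
- by rewrite big_seq1 big_nil.
- rewrite !big_cons big_nil !addr0 /=.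
  by move: (bl n 1 m m'); rewrite !scale1r.
- rewrite !big_cons big_nil !addr0 /=.
  by move: (br m 1 n n'); rewrite !scale1r.
- rewrite !big_seq1 /=.
  move: (bl n a m 0) (br m a n 0).
  by rewrite b0l b0r !addr0 => -> ->.
Qed.

End Tensor.

(* id (x) f *)
Definition tensor_map (A : comPzRingType) (M N N' : lmodType A)
    (f : {linear N -> N'}) (x : tensor M N) : tensor M N' :=
  \sum_(p <- repr x) tens p.1 (f p.2).

Lemma tensor_map_sum (A : comPzRingType) (M N N' : lmodType A)
    (f : {linear N -> N'}) (s : seq (M * N)) :
  tensor_map f (\sum_(p <- s) tens p.1 p.2) = \sum_(p <- s) tens p.1 (f p.2).
Proof.
rewrite -tens_sumE /tensor_map.
apply: (@tensor_rel_bilinear _ _ _ _ (fun m n => tens m (f n))).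
- by move=> n a m m'; rewrite tensDl tensZl.
- by move=> m a n n'; rewrite linearP tensDr tensZr.
by apply/tens_sumP; rewrite /tens_sum reprK.
Qed.

Definition flat (A : comPzRingType) (M : lmodType A) : Prop :=
  forall (N N' : lmodType A) (f : {linear N -> N'}),
    injective f -> injective (@tensor_map A M N N' f).

(* B as an A-module through f *)
Section RestrictScalars.
Variables (A B : comPzRingType) (f : {rmorphism A -> B}).

Definition restrict_scalars of {rmorphism A -> B} : Type := B.
Local Notation B_A := (restrict_scalars f).

HB.instance Definition _ := GRing.Zmodule.on B_A.

Let scalef (a : A) (b : B_A) : B_A := f a * (b : B).

Let scalefA a b x : scalef a (scalef b x) = scalef (a * b) x.
Proof. by rewrite /scalef rmorphM mulrA. Qed.

Let scale1f : left_id 1 scalef.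
Proof. by move=> x; rewrite /scalef rmorph1 mul1r. Qed.

Let scalefDr : right_distributive scalef +%R.
Proof. by move=> a x y; apply: mulrDr. Qed.

Let scalefDl x : {morph scalef^~ x : a b / a + b}.
Proof. by move=> a b; rewrite /scalef rmorphD; apply: mulrDl. Qed.

HB.instance Definition _ :=
  GRing.Zmodule_isLmodule.Build A B_A scalefA scale1f scalefDr scalefDl.

End RestrictScalars.

(* The overrings of A are taken as subrings B of the total quotient ring that
   contain the image of A. *)
Definition perinormal (A : comPzRingType) : Prop :=
  forall (B : subringClosed (total_quotient_ring A))
         (AB : forall a : A, tofracring (@Reg A) a \in B),
    going_down (corestr AB) -> flat (restrict_scalars (corestr AB)).

(* Main.v *)
(* An overring of A is, up to isomorphism, an injection i : A -> B that keeps
   regular elements regular and such that every b in B satisfies i s * b = i a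
   for some a and some regular s; this intrinsic form avoids comparing the total
   quotient rings of A and A_(M).  If A is perinormal and A_(M) -> B is a
   GD-overring, so is A -> A_(M) -> B; then B is flat over A, hence over
   A_(M), because tensoring over A or over a localization of A gives the same
   group.  Conversely let A -> B be a GD-overring, N -> N' injective and x in
   the kernel of B (x) N -> B (x) N'.  With S = Reg(A) - M, the overring
   A_(M) -> S^-1 B is going-down, hence flat, so x vanishes in
   S^-1 B (x) S^-1 N = S^-1 (B (x) N), that is, s x = 0 for some s outside M.
   The annihilator of x thus lies in no maximal ideal. *)
From HB Require Import structures.
From mathcomp Require Import all_boot all_algebra.
From mathcomp Require Import boolp classical_sets ring.
Require Import Defs.

Set Implicit Arguments.
Unset Strict Implicit.
Unset Printing Implicit Defensive.

Import GRing.Theory.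
Local Open Scope ring_scope.
Local Open Scope quotient_scope.

(** * Ideals and primes of rings of fractions *)

Section Ideals.
Variable R : comPzRingType.
Implicit Types I J P : {pred R}.

Lemma ideal0 I : is_ideal I -> 0 \in I.
Proof. by case. Qed.

Lemma idealMl I a u : is_ideal I -> u \in I -> a * u \in I.
Proof. by move=> [I0 Il] uI; rewrite -[a * u]addr0; apply: Il. Qed.

Lemma prime_idealMr P u v :
  prime_ideal P -> u \notin P -> (u * v \in P) = (v \in P).
Proof.
move=> [Pi _ Pm] uP; apply/idP/idP => [/Pm|]; last exact: idealMl.
by rewrite (negPf uP).
Qed.

(** Zorn's lemma runs over the sets [X] whose union with [I] is a proper ideal. Adjoining [I],
    rather than requiring [X] to contain it, makes the empty union of the empty chain admissible. *)
Lemma exists_maximal_ideal I :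
  is_ideal I -> 1 \notin I ->
  exists2 M : {pred R}, maximal_ideal M & {subset I <= M}.
Proof.
move=> Ii I1.
pose U (X : set R) : {pred R} := fun x => (x \in I) || `[< X x >].
pose proper (X : set R) := is_ideal (U X) /\ 1 \notin U X.
have UP (X : set R) x : reflect (x \in I \/ X x) (x \in U X).
  by apply: (iffP orP) => -[];
    [left|move/asboolP; right|left|right; apply/asboolP].
have [F FP Ftot|X [[Xi X1] Xmax]] := @Zorn_bigcup _ proper.
  split; last first.
    apply/UP => -[/(negP I1)//|[X FX X1]].
    by have [_ /UP[]] := FP X FX; right.
  split; first by apply/UP; left; apply: ideal0.
  have in1 Y a u v : F Y -> u \in U Y -> v \in U Y ->
      a * u + v \in U (\bigcup_(X in F) X)%classic.
    move=> FY uY vY; have [[_ Yl] _] := FP Y FY.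
    by have /UP[H|H] := Yl a u v uY vY; apply/UP; [left|right; exists Y].
  move=> a u v /UP[uI|[Y FY Yu]] /UP[vI|[Z FZ Zv]].
  - by apply/UP; left; case: Ii => _; apply.
  - by apply: (in1 Z) => //; apply/UP; [left|right].
  - by apply: (in1 Y) => //; apply/UP; [right|left].
  - by have [YZ|ZY] := Ftot Y Z FY FZ;
      [apply: (in1 Z)|apply: (in1 Y)] => //; apply/UP; right; auto.
exists (U X); last by move=> x xI; apply/UP; left.
split=> // J Ji J1 XJ x xJ; apply: contraT => xX.
(* As [J] contains [I], [U Y] is [J] itself; an element [x] of [J] outside [U X] would make [Y] a
   strictly larger candidate than [X]. *)
pose Y : set R := fun y => y \in J.
have UYJ : U Y =i J.
  move=> y; apply/UP/idP => [[yI|//]|]; last by right.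
  by apply: XJ; apply/UP; left.
case: (Xmax Y).
  split=> [y Xy|YX]; first by apply: XJ; apply/UP; right.
  by case/negP: xX; apply/UP; right; apply: YX.
split; last by rewrite UYJ.
by split=> [|a u v]; rewrite !UYJ; case: Ji => // _; apply.
Qed.

End Ideals.

Lemma preim_prime_ideal (A B : comPzRingType) (f : {rmorphism A -> B})
    (Q : {pred B}) :
  prime_ideal Q -> prime_ideal [preim f of Q].
Proof.
move=> [Qi Q1 Qm]; split; rewrite ?inE ?rmorph1 //.
  split=> [|a u v]; rewrite !inE ?rmorph0 ?rmorphD ?rmorphM.
    exact: ideal0.
  by case: Qi => _; apply.
by move=> u v; rewrite !inE rmorphM; apply: Qm.
Qed.

Lemma RegP (A : comPzRingType) (x : A) :
  reflect (forall y, x * y = 0 -> y = 0) (x \in @Reg A).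
Proof. exact: asboolP. Qed.

Section Fractions.
Variables (A : comPzRingType) (S : mulrClosed A).
Implicit Types (a b : A) (s t : denom S) (x y : fracring S).
Local Notation "a %:F" := (tofracring S a) (at level 1, format "a %:F").

Lemma eq_frac a s b t : a * val t = b * val s -> frac a s = frac b t.
Proof. by move=> e; apply/eq_fracP; exists 1; rewrite ?rpred1 // e. Qed.

Lemma fracD a s b t :
  frac a s + frac b t = frac (a * val t + b * val s) (denomM s t).
Proof. exact: addfE. Qed.

Lemma fracM a s b t : frac a s * frac b t = frac (a * b) (denomM s t).
Proof. exact: mulfE. Qed.

Lemma tofracK a s : (val s)%:F * frac a s = a%:F.
Proof. by rewrite fracM; apply: eq_frac => /=; ring. Qed.

Lemma tofrac_unit (a : A) : a \in S -> exists x, a%:F * x = 1.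
Proof.
by move=> aS; exists (frac 1 (mkdenom aS)); apply: (tofracK 1 (mkdenom aS)).
Qed.

Lemma tofrac_mulI (a : A) : a \in S -> injective ( *%R a%:F).
Proof.
move=> /tofrac_unit[z]; rewrite mulrC => za x y e.
by rewrite -[x]mul1r -[y]mul1r -za -!mulrA e.
Qed.

Lemma frac_divP x : exists a s, (val s)%:F * x = a%:F.
Proof. by have [a [s ->]] := fracP x; exists a, s; rewrite tofracK. Qed.

Lemma tofrac_eq0 a : a%:F = 0 -> exists2 u, u \in S & u * a = 0.
Proof.
rewrite -(rmorph0 (tofracring S)) => /eq_fracP[u uS /=].
by rewrite mul0r mulr0 mulr1 => ?; exists u.
Qed.

Section LocalizedPrime.
Variable P : {pred A}.
Hypothesis hP : prime_ideal P.
Hypothesis SP : forall a, a \in S -> a \notin P.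

(** This is the extension of [P] to the fractions; quantifying over all ways to clear a denominator
    avoids choosing a representative. *)
Definition loc_prime : {pred fracring S} :=
  fun x => `[< exists a s, a \in P /\ (val s)%:F * x = a%:F >].

(** Any representative decides membership, because the denominators and the factor [u] from the
    equality of fractions lie outside the prime [P] and can be cancelled. *)
Lemma mem_loc_prime a s : (frac a s \in loc_prime) = (a \in P).
Proof.
apply/idP/idP => [/asboolP[b [t [bP]]]|aP]; last first.
  by apply/asboolP; exists a, s; rewrite tofracK.
rewrite fracM => /eq_fracP[u uS /=]; rewrite mul1r mulr1 => e.
rewrite -(prime_idealMr _ hP (SP uS)) -(prime_idealMr _ hP (SP (valP t))).
suff -> : val t * (u * a) = (u * val s) * b by apply: idealMl => //; case: hP.
by rewrite mulrCA e mulrCA mulrC.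
Qed.

Lemma loc_prime_prime : prime_ideal loc_prime.
Proof.
have [[P0 Pl] P1 Pm] := hP; split.
- split=> [|x y z]; first by rewrite mem_loc_prime.
  have [a [s ->]] := fracP x; have [b [t ->]] := fracP y.
  have [c [r ->]] := fracP z; rewrite fracM fracD !mem_loc_prime => bP cP.
  have -> : a * b * val r + c * val (denomM s t) =
    (a * val r) * b + (val s * val t) * c by rewrite /=; ring.
  by apply/Pl/idealMl.
- by rewrite mem_loc_prime.
- move=> x y; have [a [s ->]] := fracP x; have [b [t ->]] := fracP y.
  by rewrite fracM !mem_loc_prime; apply: Pm.
Qed.

Lemma preim_loc_prime : [preim tofracring S of loc_prime] =i P.
Proof. by move=> a; rewrite !inE mem_loc_prime. Qed.

End LocalizedPrime.

Section PrimeOfFractions.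
Variable Q : {pred fracring S}.
Hypothesis hQ : prime_ideal Q.

Lemma prime_fracring_avoids a : a \in S -> a%:F \notin Q.
Proof.
move=> /tofrac_unit[z az]; have [Qi Q1 _] := hQ.
by apply: contra Q1 => aQ; rewrite -az mulrC; apply: idealMl.
Qed.

Lemma prime_fracring_frac a s : (frac a s \in Q) = (a%:F \in Q).
Proof.
by rewrite -(prime_idealMr _ hQ (prime_fracring_avoids (valP s))) tofracK.
Qed.

Lemma loc_prime_sub (P : {pred A}) : (forall a, a \in P -> a%:F \in Q) ->
  {subset loc_prime P <= Q}.
Proof.
move=> PQ x /asboolP[a [s [aP e]]].
by rewrite -(prime_idealMr _ hQ (prime_fracring_avoids (valP s))) e PQ.
Qed.

End PrimeOfFractions.

(** A prime of the fractions contains no image of [S], so [P2], and with it the smaller [P1], avoids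
    [S]. Hence the extension of [P1] is a prime that contracts to [P1]. *)
Lemma going_down_tofracring : going_down (tofracring S).
Proof.
move=> P1 P2 Q2 hP1 hP2 P12 hQ2 Q2P2.
have SP1 a : a \in S -> a \notin P1.
  move=> aS; apply: contra (prime_fracring_avoids hQ2 aS) => /P12.
  by rewrite -Q2P2.
exists (loc_prime P1); split; first exact: loc_prime_prime.
- by apply: loc_prime_sub => // a /P12; rewrite -Q2P2.
- exact: preim_loc_prime.
Qed.

End Fractions.

(** The middle prime is the contraction of [Q2] to [B]: descend first along [f] below it, then along
    [g]. The pointwise equation admits morphisms [h] that are not literally composites. *)
Lemma going_down_comp (A B C : comPzRingType) (f : {rmorphism A -> B})
    (g : {rmorphism B -> C}) (h : {rmorphism A -> C}) :
  h =1 g \o f -> going_down f -> going_down g -> going_down h.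
Proof.
move=> hE GDf GDg P1 P2 Q2 hP1 hP2 P12 hQ2 Q2P2.
have hQ := preim_prime_ideal g hQ2.
have [|R1 [hR1 R1Q R1P]] := GDf P1 P2 _ hP1 hP2 P12 hQ.
  by move=> a; rewrite -Q2P2 !inE hE.
have [//|Q1 [hQ1 Q12 Q1R]] := GDg R1 _ Q2 hR1 hQ R1Q hQ2.
exists Q1; split=> // a; rewrite -R1P [RHS]inE -Q1R !inE.
by rewrite hE.
Qed.

(** * Tensor products and flatness under change of rings *)

Section TensorRelations.
Variables (A A' : comPzRingType) (f : {rmorphism A -> A'}).

(** One induction serves three purposes: functoriality over a single ring ([f] the identity),
    passage to modules of fractions, and reading an [A]-relation as an [A']-relation ([u] and [v]
    identities). *)
Lemma tensor_rel_semilinear (M N : lmodType A) (M' N' : lmodType A')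
    (u : M -> M') (v : N -> N') :
  {morph u : x y / x + y} -> (forall a x, u (a *: x) = f a *: u x) ->
  {morph v : x y / x + y} -> (forall a x, v (a *: x) = f a *: v x) ->
  forall s t, tensor_rel s t ->
    tensor_rel [seq (u p.1, v p.2) | p <- s] [seq (u p.1, v p.2) | p <- t].
Proof.
move=> uD uZ vD vZ s t.
elim=> {s t} [s|s t _|s t r _ + _|s s' t t' _ + _|s t|n|m m' n|m n n'|a m n] /=.
- exact: tensor_refl.
- exact: tensor_sym.
- exact: tensor_trans.
- by rewrite !map_cat; apply: tensor_cat.
- by rewrite !map_cat; apply: tensor_catC.
- by rewrite -(scale0r 0) uZ rmorph0 scale0r; apply: tensor_0l.
- by rewrite uD; apply: tensor_Dl.
- by rewrite vD; apply: tensor_Dr.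
- by rewrite uZ vZ; apply: tensor_Z.
Qed.

Section RestrictModule.
Variable M : lmodType A'.

(** While [restrict_scalars] starts from a ring, this starts from any [A']-module, such as the test
    modules for flatness. The morphism argument selects the module structure. *)
Definition restrict_module of {rmorphism A -> A'} : Type := M.
Local Notation M_A := (restrict_module f).

HB.instance Definition _ := GRing.Zmodule.on M_A.

Let scalem (a : A) (x : M_A) : M_A := f a *: (x : M).

Let scalemA a b x : scalem a (scalem b x) = scalem (a * b) x.
Proof. by rewrite /scalem scalerA rmorphM. Qed.

Let scale1m : left_id 1 scalem.
Proof. by move=> x; rewrite /scalem rmorph1 scale1r. Qed.

Let scalemDr : right_distributive scalem +%R.
Proof. by move=> a x y; apply: scalerDr. Qed.

Let scalemDl x : {morph scalem^~ x : a b / a + b}.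
Proof. by move=> a b; rewrite /scalem rmorphD; apply: scalerDl. Qed.

HB.instance Definition _ :=
  GRing.Zmodule_isLmodule.Build A M_A scalemA scale1m scalemDr scalemDl.

End RestrictModule.

(* Injectivity of A -> A' up to S-torsion plays no role, so it is left out. *)
Definition is_localization := forall x : A', exists s a z,
  z * f s = 1 /\ f s * x = f a.

(* With x = a/s, m (x) n = s m (x) (1/s) n moves x across the tensor sign. *)
Lemma tensor_rel_localization (M N : lmodType A') (s t : seq (M * N)) :
  is_localization -> tensor_rel s t ->
  @tensor_rel A (restrict_module M f) (restrict_module N f) s t.
Proof.
move=> floc.
elim=> {s t} [s|s t _|s t r _ + _|s s' t t' _ + _|s t|n|m m' n|m n n'|x m n] /=.
- exact: tensor_refl.
- exact: tensor_sym.
- exact: tensor_trans.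
- exact: tensor_cat.
- exact: tensor_catC.
- exact: tensor_0l.
- exact: tensor_Dl.
- exact: tensor_Dr.
have [s [a [z [zs sx]]]] := floc x.
pose MA : lmodType A := restrict_module M f.
pose NA : lmodType A := restrict_module N f.
have Hs := @tensor_Z A MA NA s (x *: m) (z *: n).
have Ha := @tensor_Z A MA NA a m (z *: n).
have E1 : (s *: (z *: n : NA)) = n.
  by rewrite -[LHS]/(f s *: (z *: n)) scalerA mulrC zs scale1r.
have E2 : (s *: (x *: m : MA)) = a *: (m : MA).
  by rewrite -[LHS]/(f s *: (x *: m)) scalerA sx.
have E3 : a *: (z *: n : NA) = x *: n.
  rewrite -[LHS]/(f a *: (z *: n)) scalerA -sx.
  by rewrite mulrAC [f s * z]mulrC zs mul1r.
by move: Hs Ha; rewrite E1 E2 E3 => /tensor_sym; apply: tensor_trans.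
Qed.

End TensorRelations.

Arguments restrict_module {A A'} M f.

Section Flat.
Variable A : comPzRingType.

(** Flatness as triviality of kernels, phrased on formal sums so that inductions on [tensor_rel]
    apply directly. *)
Lemma flatP (M : lmodType A) :
  flat M <-> forall (N N' : lmodType A) (f : {linear N -> N'}), injective f ->
    forall s : seq (M * N), tensor_rel [seq (p.1, f p.2) | p <- s] [::] ->
      tensor_rel s [::].
Proof.
have mapE (N N' : lmodType A) (f : {linear N -> N'}) (s : seq (M * N)) :
    tensor_map f (tens_sum s) = tens_sum [seq (p.1, f p.2) | p <- s].
  by rewrite !tens_sumE tensor_map_sum big_map.
split=> [Mflat N N' f finj s /tens_sumP es|H N N' f finj x y].
  by apply/tens_sumP/(Mflat _ _ _ finj); rewrite !mapE.
elim/quotW: x => s; elim/quotW: y => t; rewrite -!/(tens_sum _) !mapE => e.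
(* A difference of tensors is again a formal sum: the sign goes to the left factor, which [f] leaves
   alone. *)
have sumB (K : lmodType A) (s' t' : seq (M * K)) :
    tens_sum s' - tens_sum t' = tens_sum (s' ++ [seq (- p.1, p.2) | p <- t']).
  rewrite !tens_sumE big_cat big_map /= -sumrN; congr (_ + _).
  by apply: eq_bigr => p _; rewrite -[- p.1]scaleN1r tensZl scaleN1r.
apply/eqP; rewrite -subr_eq0 sumB; apply/eqP/tens_sumP/(H _ _ _ finj)/tens_sumP.
rewrite map_cat -map_comp -[LHS]/(tens_sum (_ ++ map ((fun p => (- p.1, p.2)) \o
  (fun p => (p.1, f p.2))) t)) map_comp -sumB e subrr.
by [].
Qed.

(** A relation is carried to [M] by [v], resolved there by flatness and carried back by [u]. The
    inverse [v] may be a bare function because it inherits linearity from [u]. *)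
Lemma flat_iso (M M' : lmodType A) (u : {linear M -> M'}) (v : M' -> M) :
  cancel u v -> cancel v u -> flat M -> flat M'.
Proof.
move=> uK vK /flatP Mflat; apply/flatP => N N' f finj s.
have vD : {morph v : x y / x + y}.
  by move=> x y; apply: (can_inj uK); rewrite linearD !vK.
have vZ a x : v (a *: x) = a *: v x.
  by apply: (can_inj uK); rewrite linearZ !vK.
move=> /(@tensor_rel_semilinear _ _ idfun _ _ M N' v id vD vZ
  (fun _ _ => erefl) (fun _ _ => erefl)).
rewrite -map_comp => h.
have := Mflat N N' f finj [seq (v p.1, p.2) | p <- s].
rewrite -map_comp => /(_ h).
move=> /(@tensor_rel_semilinear _ _ idfun _ _ M' N u id (linearD u)
  (fun a x => linearZ _ _) (fun _ _ => erefl) (fun _ _ => erefl)).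
rewrite -map_comp (eq_map (g := id)) ?map_id // => -[m n] /=.
by rewrite vK.
Qed.

End Flat.

(** Over a localization, a relation over [A'] is already one over [A]; flatness over [A] resolves
    it, and the result is read over [A'] again. *)
Lemma flat_localization (A A' : comPzRingType) (f : {rmorphism A -> A'})
    (M : lmodType A') :
  is_localization f -> flat (restrict_module M f) -> flat M.
Proof.
move=> floc /flatP Mflat; apply/flatP => N N' g ginj s.
move=> /(tensor_rel_localization floc) h.
have gA : linear (g : restrict_module N f -> restrict_module N' f).
  by move=> a x y; apply: linearP.
pose g' := GRing.isLinear.Build _ _ _ _ _ gA.
pose G : {linear restrict_module N f -> restrict_module N' f} :=
  HB.pack (g : restrict_module N f -> restrict_module N' f) g'.
have := Mflat _ _ G ginj s h.
move=> /(@tensor_rel_semilinear _ _ f (restrict_module M f)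
  (restrict_module N f) M N id id
  (fun _ _ => erefl) (fun _ _ => erefl) (fun _ _ => erefl) (fun _ _ => erefl)).
by rewrite (eq_map (g := id)) ?map_id // => -[].
Qed.

(** * Overrings up to isomorphism *)

(** The required prime is the image of [P1], expressed as a preimage under the inverse [g], which
    respects the ring operations because [f] does. *)
Lemma bij_going_down (A B : comPzRingType) (f : {rmorphism A -> B}) :
  bijective f -> going_down f.
Proof.
move=> [g fK gK] P1 P2 Q2 hP1 hP2 P12 hQ2 Q2P2.
have gD a x y : g (a * x + y) = g a * g x + g y.
  by apply: (can_inj fK); rewrite rmorphD rmorphM !gK.
have gM x y : g (x * y) = g x * g y.
  by apply: (can_inj fK); rewrite rmorphM !gK.
have [[P10 P1l] P11 P1m] := hP1.
exists ([preim g of P1] : {pred B}); split; last by move=> a; rewrite !inE fK.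
- split=> [||x y]; rewrite ?inE.
  + split=> [|a x y]; rewrite !inE ?gD; last exact: P1l.
    by rewrite -(rmorph0 f) fK.
  + by rewrite -(rmorph1 f) fK.
  + by rewrite gM; apply: P1m.
- by move=> x /P12; rewrite -Q2P2 inE gK.
Qed.

Definition overring_map (A B : comPzRingType) (i : {rmorphism A -> B}) : Prop :=
  [/\ injective i, {homo i : s / s \in @Reg A >-> s \in @Reg B} &
      forall b, exists2 s, s \in @Reg A & exists a, i s * b = i a].

Section OverringEmbedding.
Variables (A B : comPzRingType) (i : {rmorphism A -> B}).
Hypothesis iov : overring_map i.
Local Notation K := (total_quotient_ring A).

Let clear_denom b : {p : A * denom (@Reg A) | i (val p.2) * b = i p.1}.
Proof.
apply: cid; have [_ _ /(_ b)[s sR [a sa]]] := iov.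
by exists (a, mkdenom sR).
Qed.

Definition overring_embed (b : B) : K :=
  let: exist p _ := clear_denom b in frac p.1 p.2.
Local Notation psi := overring_embed.

(** Independence of the chosen pair: two ways of clearing the denominator of [b] agree after
    cross-multiplication in [B], and injectivity of [i] brings this back to [A]. *)
Let psiE b a (s : denom (@Reg A)) : i (val s) * b = i a -> psi b = frac a s.
Proof.
rewrite /psi; case: (clear_denom b) => -[c t] /= tb sb.
apply: eq_frac; have [inj _ _] := iov; apply: inj.
by rewrite !rmorphM -tb -sb; ring.
Qed.

Let psi_frac b : exists a (s : denom (@Reg A)),
  i (val s) * b = i a /\ psi b = frac a s.
Proof.
by rewrite /psi; case: (clear_denom b) => -[a s] e; exists a, s.
Qed.

Lemma overring_embed_is_zmod_morphism : zmod_morphism psi.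
Proof.
move=> b c; have [a [s [sb ->]]] := psi_frac b.
have [d [t [tc ->]]] := psi_frac c.
rewrite -[RHS]/(addf _ (oppf _)) oppfE addfE; apply: psiE.
rewrite /= rmorphD !rmorphM rmorphN -sb -tc.
by ring.
Qed.

Lemma overring_embed_is_monoid_morphism : monoid_morphism psi.
Proof.
split=> [|b c]; first by apply: psiE; rewrite rmorph1 mulr1.
have [a [s [sb ->]]] := psi_frac b; have [d [t [tc ->]]] := psi_frac c.
rewrite fracM; apply: psiE; rewrite /= !rmorphM -sb -tc.
by ring.
Qed.

HB.instance Definition _ :=
  GRing.isZmodMorphism.Build B K psi overring_embed_is_zmod_morphism.
HB.instance Definition _ :=
  GRing.isMonoidMorphism.Build B K psi overring_embed_is_monoid_morphism.

Lemma overring_embed_tofracring a : psi (i a) = tofracring (@Reg A) a.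
Proof. by apply: psiE; rewrite rmorph1 mul1r. Qed.

(** Equal fractions give elements of [B] that agree after multiplication by images of regular
    elements of [A]; these images are regular in [B] and cancel. *)
Lemma overring_embed_inj : injective psi.
Proof.
have [_ iR _] := iov.
move=> b c; have [a [s [sb ->]]] := psi_frac b.
have [d [t [tc ->]]] := psi_frac c => /eq_fracP[u /iR/RegP uR].
move=> /(congr1 i); rewrite !rmorphM -sb -tc => e.
have /iR/RegP sR := valP s; have /iR/RegP tR := valP t.
apply/eqP; rewrite -subr_eq0; apply/eqP/sR/tR/uR.
apply/eqP; rewrite !mulrBr subr_eq0; apply/eqP.
rewrite [i (val t) * _]mulrC e; congr (_ * _).
by rewrite mulrC [i _ * c]mulrC mulrA mulrC.
Qed.

Definition overring_image : {pred K} := fun k => `[< exists b, psi b = k >].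

Lemma mem_overring_image b : psi b \in overring_image.
Proof. by apply/asboolP; exists b. Qed.

Lemma overring_image_subring_closed : subring_closed overring_image.
Proof.
split=> [|k l /asboolP[b <-] /asboolP[c <-]|k l /asboolP[b <-] /asboolP[c <-]].
- by rewrite -(rmorph1 psi) mem_overring_image.
- by rewrite -rmorphB mem_overring_image.
- by rewrite -rmorphM mem_overring_image.
Qed.

HB.instance Definition _ :=
  GRing.isSubringClosed.Build K overring_image overring_image_subring_closed.

Lemma overring_image_tofracring a : tofracring (@Reg A) a \in overring_image.
Proof. by rewrite -overring_embed_tofracring mem_overring_image. Qed.

(** [B] is replaced by its image [C] in [K], a literal overring. Going down reaches [C] by composing
    with the isomorphism [theta], and flatness returns along its inverse [eta]. *)
Lemma perinormal_overring_flat :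
  perinormal A -> going_down i -> flat (restrict_scalars i).
Proof.
move=> perA GDi.
pose C := overring_image : subringClosed K.
pose theta : {rmorphism B -> subring_sort C} :=
  @corestr B K psi C mem_overring_image.
pose h : {rmorphism A -> subring_sort C} :=
  @corestr A K (tofracring (@Reg A)) C overring_image_tofracring.
have inv (y : subring_sort C) : {b | theta b = y}.
  apply: cid; have /asboolP[b e] := valP y.
  by exists b; apply: val_inj.
pose eta y := sval (inv y).
have etaK : cancel eta theta by move=> y; rewrite /eta; case: (inv y).
have thetaK : cancel theta eta.
  by move=> b; apply: overring_embed_inj; apply: (congr1 val (etaK (theta b))).
have hE : h =1 theta \o i.
  by move=> a; apply: val_inj; rewrite /= overring_embed_tofracring.
have GDh : going_down h.
  by apply: (going_down_comp hE GDi); apply: bij_going_down; exists eta.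
have etaL : linear (eta : restrict_scalars h -> restrict_scalars i).
  move=> a x y; apply: (can_inj thetaK).
  rewrite -[X in theta (X + _)]/(i a * eta x) -[X in eta (X + _)]/(h a * x).
  by rewrite rmorphD rmorphM !etaK hE.
pose u : {linear restrict_scalars h -> restrict_scalars i} :=
  HB.pack (eta : restrict_scalars h -> restrict_scalars i)
    (GRing.isLinear.Build _ _ _ _ _ etaL).
exact: (@flat_iso _ _ _ u theta etaK thetaK (perA _ _ GDh)).
Qed.

End OverringEmbedding.

Lemma perinormalP (A : comPzRingType) :
  perinormal A <->
  forall (B : comPzRingType) (i : {rmorphism A -> B}),
    overring_map i -> going_down i -> flat (restrict_scalars i).
Proof.
split=> [perA B i iov|H B AB]; first exact: perinormal_overring_flat.
apply: H; split.
- move=> a b /(congr1 val); exact: tofracring_inj.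
(* A regular element of [A] becomes a unit in the total quotient ring, so it is regular in the
   subring [B]. *)
- move=> s sR; apply/RegP => y /(congr1 val) /= sy0.
  by apply: val_inj; apply: (tofrac_mulI sR); rewrite mulr0.
- move=> b; have [a [s e]] := frac_divP (val b).
  exists (val s); first exact: valP s.
  by exists a; apply: val_inj.
Qed.

(** * Perinormality passes to rings of fractions *)

Lemma is_localization_tofracring (A : comPzRingType) (S : mulrClosed A) :
  is_localization (tofracring S).
Proof.
move=> x; have [a [s e]] := frac_divP x; have [z zs] := tofrac_unit (valP s).
by exists (val s), a, z; rewrite mulrC.
Qed.

Lemma tofracring_Reg (A : comPzRingType) (S : mulrClosed A) (s : A) :
  s \in @Reg A -> tofracring S s \in @Reg (fracring S).
Proof.
move=> /RegP sR; apply/RegP => y; have [b [t ->]] := fracP y => e.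
have : tofracring S (s * b) = 0.
  by rewrite rmorphM /= -(tofracK b t) mulrCA e mulr0.
move=> /tofrac_eq0[u uS]; rewrite mulrCA => /sR ub.
by rewrite -[0](rmorph0 (tofracring S)); apply/eq_fracP; exists u;
  rewrite // mulr1 ub mul0r mulr0.
Qed.

Lemma Reg_frac (A : comPzRingType) (S : mulrClosed A) (a : A) (s : denom S) :
  {subset S <= @Reg A} -> frac a s \in @Reg (fracring S) -> a \in @Reg A.
Proof.
move=> SR /RegP aR; apply/RegP => y ay.
apply: (tofracring_inj SR); rewrite rmorph0; apply: aR.
apply: (tofrac_mulI (valP s)).
by rewrite mulrA tofracK -rmorphM ay rmorph0 mulr0.
Qed.

Lemma perinormal_fracring (A : comPzRingType) (S : mulrClosed A) :
  {subset S <= @Reg A} -> perinormal A -> perinormal (fracring S).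
Proof.
move=> SR /perinormalP perA; apply/perinormalP => B j [jinj jR jden] GDj.
pose i : {rmorphism A -> B} := j \o tofracring S.
have iov : overring_map i.
  split=> [a b /jinj/(tofracring_inj SR)//|s /tofracring_Reg/jR|b].
    by apply.
  have [x xR [y xy]] := jden b.
  have [a [s xE]] := fracP x; have [c [t yE]] := fracP y.
  (* With [x] = [a]/[s] and [y] = [c]/[t], clearing denominators in [j x * b = j y] gives
     [i (a * t) * b = i (c * s)]; [a] is regular because [x] is. *)
  exists (a * val t).
    rewrite xE in xR.
    exact: rpredM (Reg_frac SR xR) (SR _ (valP t)).
  exists (c * val s).
  rewrite /i /= !rmorphM.
  have -> : j (tofracring S a) = j (tofracring S (val s)) * j x.
    by rewrite -rmorphM xE tofracK.
  have -> : j (tofracring S c) = j (tofracring S (val t)) * j y.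
    by rewrite -rmorphM yE tofracK.
  rewrite -xy.
  by ring.
have GDi : going_down i.
  exact: going_down_comp (fun=> erefl) (@going_down_tofracring _ S) GDj.
have iflat := perA B i iov GDi.
apply: (flat_localization (@is_localization_tofracring _ S)).
(* Restricting in one step along [i] or in two steps through [j] gives convertible module
   structures. *)
have idL : linear (id : restrict_scalars i ->
    restrict_module (restrict_scalars j) (tofracring S)) by [].
pose u : {linear restrict_scalars i ->
    restrict_module (restrict_scalars j) (tofracring S)} :=
  HB.pack (id : restrict_scalars i ->
    restrict_module (restrict_scalars j) (tofracring S))
    (GRing.isLinear.Build _ _ _ _ _ idL).
exact: (@flat_iso _ _ _ u id (fun=> erefl) (fun=> erefl) iflat).
Qed.

(** * Modules of fractions *)

Section ModuleFractions.
Variables (A : comPzRingType) (S : mulrClosed A) (N : lmodType A).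
Local Notation den := (denom S).

Definition mfrac_equiv (x y : N * den) : bool :=
  `[< exists2 u, u \in S & u *: (val y.2 *: x.1) = u *: (val x.2 *: y.1) >].

Lemma mfrac_equiv_refl : reflexive mfrac_equiv.
Proof. by move=> x; apply/asboolP; exists 1; rewrite ?rpred1. Qed.

Lemma mfrac_equiv_sym : symmetric mfrac_equiv.
Proof. by move=> x y; apply/asboolP/asboolP => -[u uS e]; exists u. Qed.

Lemma mfrac_equiv_trans : transitive mfrac_equiv.
Proof.
move=> [m [t tS]] [n [s sS]] [k [r rS]] /asboolP[u uS /= e] /asboolP[v vS /= f].
apply/asboolP; exists (u * v * t) => /=; first by rewrite !rpredM.
have -> : (u * v * t) *: (r *: n) = (v * r) *: (u *: (t *: n)).
  by rewrite !scalerA; congr (_ *: _); ring.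
have -> : (u * v * t) *: (s *: k) = (u * s) *: (v *: (t *: k)).
  by rewrite !scalerA; congr (_ *: _); ring.
by rewrite e -f !scalerA; congr (_ *: _); ring.
Qed.

Canonical mfrac_equiv_equiv :=
  EquivRel mfrac_equiv mfrac_equiv_refl mfrac_equiv_sym mfrac_equiv_trans.

(** The scalars will be [fracring S], not just [A]: the flatness available for a localized overring
    is over that ring. *)
Definition fracmod := {eq_quot mfrac_equiv}.
HB.instance Definition _ := EqQuotient.on fracmod.
HB.instance Definition _ := Choice.on fracmod.

Definition mfrac (n : N) (s : den) : fracmod := \pi_fracmod (n, s).

Lemma mfracP (x : fracmod) : exists n s, x = mfrac n s.
Proof. by elim/quotW: x => -[n s]; exists n, s. Qed.

Lemma eq_mfracP n s m t : mfrac n s = mfrac m t <->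
  exists2 u, u \in S & u *: (val t *: n) = u *: (val s *: m).
Proof.
by rewrite /mfrac; split=> [/eqmodP/asboolP //|h]; apply/eqmodP/asboolP.
Qed.

Lemma eq_mfrac n s m t : val t *: n = val s *: m -> mfrac n s = mfrac m t.
Proof. by move=> e; apply/eq_mfracP; exists 1; rewrite ?rpred1 // e. Qed.

Let num (x : fracmod) : N := (repr x).1.
Let dnm (x : fracmod) : den := (repr x).2.
Let numdnmK x : mfrac (num x) (dnm x) = x.
Proof. by rewrite /mfrac /num /dnm -surjective_pairing reprK. Qed.

Definition addm (x y : fracmod) : fracmod :=
  mfrac (val (dnm y) *: num x + val (dnm x) *: num y) (denomM (dnm x) (dnm y)).
Definition oppm (x : fracmod) : fracmod := mfrac (- num x) (dnm x).
Definition scalem (a : fracring S) (x : fracmod) : fracmod :=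
  mfrac ((repr a).1 *: num x) (denomM (repr a).2 (dnm x)).

Lemma addmE n s m t :
  addm (mfrac n s) (mfrac m t) = mfrac (val t *: n + val s *: m) (denomM s t).
Proof.
rewrite /addm; move: (numdnmK (mfrac n s)) (numdnmK (mfrac m t)).
move: (num (mfrac n s)) (dnm (mfrac n s)) (num (mfrac m t)) (dnm (mfrac m t)).
case: s t => [s sS] [t tS] n' [s' s'S] m' [t' t'S].
move=> /eq_mfracP[u uS /= e] /eq_mfracP[v vS /= f]; apply/eq_mfracP.
exists (u * v) => /=; first exact: rpredM.
rewrite !scalerDr; congr (_ + _).
  transitivity ((v * t * t') *: (u *: (s *: n'))).
    by rewrite !scalerA; congr (_ *: _); ring.
  by rewrite e !scalerA; congr (_ *: _); ring.
transitivity ((u * s * s') *: (v *: (t *: m'))).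
  by rewrite !scalerA; congr (_ *: _); ring.
by rewrite f !scalerA; congr (_ *: _); ring.
Qed.

Lemma oppmE n s : oppm (mfrac n s) = mfrac (- n) s.
Proof.
rewrite /oppm; move: (numdnmK (mfrac n s)).
set n' := num _; set s' := dnm _ => /eq_mfracP[u uS e].
by apply/eq_mfracP; exists u; rewrite // !scalerN e.
Qed.

Lemma scalemE a s n t :
  scalem (frac a s) (mfrac n t) = mfrac (a *: n) (denomM s t).
Proof.
have : frac (repr (frac a s)).1 (repr (frac a s)).2 = frac a s.
  by rewrite /frac -surjective_pairing reprK.
rewrite /scalem; move: (numdnmK (mfrac n t)).
move: (repr (frac a s)) (num (mfrac n t)) (dnm (mfrac n t)).
case: s t => [s sS] [t tS] [a' [s' s'S]] n' [t' t'S].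
move=> /eq_mfracP[u uS /= e] /eq_fracP[v vS /= f]; apply/eq_mfracP.
exists (u * v) => /=; first exact: rpredM.
transitivity ((v * (a' * s)) *: (u *: (t *: n'))).
  by rewrite !scalerA; congr (_ *: _); ring.
by rewrite e f !scalerA; congr (_ *: _); ring.
Qed.

Let addmA : associative addm.
Proof.
move=> x y z; have [n [[s sS] ->]] := mfracP x.
have [m [[t tS] ->]] := mfracP y.
have [k [[r rS] ->]] := mfracP z; rewrite !addmE; apply: eq_mfrac => /=.
by rewrite !scalerDr !scalerA addrA; do 2?congr (_ + _); congr (_ *: _); ring.
Qed.

Let addmC : commutative addm.
Proof.
move=> x y; have [n [[s sS] ->]] := mfracP x; have [m [[t tS] ->]] := mfracP y.
by rewrite !addmE addrC; apply: eq_mfrac => /=; rewrite [t * _]mulrC.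
Qed.

Let add0m : left_id (mfrac 0 (denom1 S)) addm.
Proof.
move=> x; have [n [[s sS] ->]] := mfracP x.
by rewrite addmE; apply: eq_mfrac; rewrite /= scaler0 add0r scale1r mul1r.
Qed.

Let addNm : left_inverse (mfrac 0 (denom1 S)) oppm addm.
Proof.
move=> x; have [n [[s sS] ->]] := mfracP x.
by rewrite oppmE addmE; apply: eq_mfrac; rewrite /= scalerN addNr !scaler0.
Qed.

HB.instance Definition _ :=
  GRing.isZmodule.Build fracmod addmA addmC add0m addNm.

Let scalemA a b x : scalem a (scalem b x) = scalem (a * b) x.
Proof.
have [c [[s sS] ->]] := fracP a; have [d [[t tS] ->]] := fracP b.
have [n [[r rS] ->]] := mfracP x; rewrite fracM !scalemE; apply: eq_mfrac => /=.
by rewrite !scalerA; congr (_ *: _); ring.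
Qed.

Let scale1m : left_id 1 scalem.
Proof.
move=> x; have [n [[s sS] ->]] := mfracP x.
rewrite -[1]/(frac 1 (denom1 S)) scalemE; apply: eq_mfrac.
by rewrite /= scale1r mul1r.
Qed.

Let scalemDr : right_distributive scalem +%R.
Proof.
move=> a x y; have [c [[s sS] ->]] := fracP a.
have [n [[r rS] ->]] := mfracP x; have [m [[t tS] ->]] := mfracP y.
rewrite -[mfrac n _ + _]/(addm _ _) -[RHS]/(addm _ _).
rewrite !(addmE, scalemE); apply: eq_mfrac => /=.
by rewrite !scalerDr !scalerA; congr (_ + _); congr (_ *: _); ring.
Qed.

Let scalemDl x : {morph scalem^~ x : a b / a + b}.
Proof.
move=> a b; have [c [[s sS] ->]] := fracP a; have [d [[t tS] ->]] := fracP b.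
have [n [[r rS] ->]] := mfracP x; rewrite -[RHS]/(addm _ _) fracD.
rewrite !(addmE, scalemE); apply: eq_mfrac => /=.
by rewrite !(scalerDr, scalerA, scalerDl, mulrDr, mulrDl); congr (_ + _);
  congr (_ *: _); ring.
Qed.

HB.instance Definition _ :=
  GRing.Zmodule_isLmodule.Build (fracring S) fracmod
    scalemA scale1m scalemDr scalemDl.

Lemma mfracD n s m t :
  mfrac n s + mfrac m t = mfrac (val t *: n + val s *: m) (denomM s t).
Proof. exact: addmE. Qed.

Lemma mfracZ a s n t : frac a s *: mfrac n t = mfrac (a *: n) (denomM s t).
Proof. exact: scalemE. Qed.

Lemma mfrac_eq0 n s : mfrac n s = 0 -> exists2 u, u \in S & u *: n = 0.
Proof.
move=> /eq_mfracP[u uS] /=; rewrite scale1r !scaler0 => e.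
by exists u.
Qed.

Definition tofracmod (n : N) : fracmod := mfrac n (denom1 S).

Lemma tofracmodD : {morph tofracmod : m n / m + n}.
Proof.
move=> m n; rewrite mfracD; apply: eq_mfrac.
by rewrite /= !scale1r mul1r scale1r.
Qed.

Lemma tofracmodZ a n : tofracmod (a *: n) = tofracring S a *: tofracmod n.
Proof. by rewrite mfracZ; apply: eq_mfrac; rewrite /= mul1r. Qed.

End ModuleFractions.

Section ModuleFractionsMap.
Variables (A : comPzRingType) (S : mulrClosed A) (N N' : lmodType A).
Variable f : {linear N -> N'}.

Definition fracmod_map (x : fracmod S N) : fracmod S N' :=
  mfrac (f (repr x).1) (repr x).2.

Let fZ a x : f (a *: x) = a *: f x.
Proof. exact: linearZ. Qed.

Lemma fracmod_mapE n s : fracmod_map (mfrac n s) = mfrac (f n) s.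
Proof.
have : mfrac (repr (mfrac n s)).1 (repr (mfrac n s)).2 = mfrac n s.
  by rewrite /mfrac -surjective_pairing reprK.
rewrite /fracmod_map => /eq_mfracP[u uS e]; apply/eq_mfracP; exists u => //.
by rewrite -!fZ e.
Qed.

Lemma fracmod_map_linear : linear fracmod_map.
Proof.
move=> a x y; have [c [s ->]] := fracP a.
have [n [t ->]] := mfracP x; have [m [r ->]] := mfracP y.
by rewrite mfracZ mfracD !fracmod_mapE mfracZ mfracD (linearD f) !fZ.
Qed.

HB.instance Definition _ :=
  GRing.isLinear.Build (fracring S) (fracmod S N) (fracmod S N') *:%R
    fracmod_map fracmod_map_linear.

(** An equality of images holds in [N'] after scaling by some [u] in [S]; linearity and injectivity
    of [f] pull this scaled equality back to [N]. *)
Lemma fracmod_map_inj : injective f -> injective fracmod_map.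
Proof.
move=> finj x y; have [n [s ->]] := mfracP x; have [m [t ->]] := mfracP y.
rewrite !fracmod_mapE => /eq_mfracP[u uS e]; apply/eq_mfracP; exists u => //.
by apply: finj; rewrite !fZ.
Qed.

End ModuleFractionsMap.

(** * Localizing an overring *)

Section ImageFractions.
Variables (A B : comPzRingType) (i : {rmorphism A -> B}) (S : mulrClosed A).

(** Taking the image of [S] as denominators makes the localization of [B] a ring of fractions, so
    the results on [fracring] cover it. *)
Definition image_denoms : {pred B} :=
  fun b => `[< exists2 s, s \in S & i s = b >].

Lemma mem_image_denoms s : s \in S -> i s \in image_denoms.
Proof. by move=> sS; apply/asboolP; exists s. Qed.

Lemma image_denoms_mulr_closed : mulr_closed image_denoms.
Proof.
split=> [|b c /asboolP[s sS <-] /asboolP[t tS <-]].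
  by rewrite -(rmorph1 i) mem_image_denoms ?rpred1.
by rewrite -rmorphM mem_image_denoms ?rpredM.
Qed.
HB.instance Definition _ :=
  GRing.isMulClosed.Build B image_denoms image_denoms_mulr_closed.

Local Notation T := (image_denoms : mulrClosed B).

Definition image_denom (s : denom S) : denom T :=
  mkdenom (mem_image_denoms (valP s)).

Definition frac_map (x : fracring S) : fracring T :=
  frac (i (repr x).1) (image_denom (repr x).2).

Lemma frac_mapE a s : frac_map (frac a s) = frac (i a) (image_denom s).
Proof.
have : frac (repr (frac a s)).1 (repr (frac a s)).2 = frac a s.
  by rewrite /frac -surjective_pairing reprK.
rewrite /frac_map => /eq_fracP[u uS e]; apply/eq_fracP.
exists (i u); first exact: mem_image_denoms.
by rewrite /= -!rmorphM e.
Qed.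

Lemma frac_map_is_zmod_morphism : zmod_morphism frac_map.
Proof.
move=> x y; have [a [s ->]] := fracP x; have [b [t ->]] := fracP y.
rewrite -[frac a s - _]/(addf _ (oppf _)) oppfE addfE !frac_mapE.
rewrite -[RHS]/(addf _ (oppf _)) oppfE addfE; apply: eq_frac.
by rewrite /= !(rmorphM, rmorphD, rmorphN).
Qed.

Lemma frac_map_is_monoid_morphism : monoid_morphism frac_map.
Proof.
split=> [|x y].
  by rewrite -[1]/(frac 1 (denom1 S)) frac_mapE; apply: eq_frac;
    rewrite /= !rmorph1.
have [a [s ->]] := fracP x; have [b [t ->]] := fracP y.
rewrite fracM !frac_mapE fracM; apply: eq_frac.
by rewrite /= !rmorphM.
Qed.

HB.instance Definition _ :=
  GRing.isZmodMorphism.Build (fracring S) (fracring T) frac_map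
    frac_map_is_zmod_morphism.
HB.instance Definition _ :=
  GRing.isMonoidMorphism.Build (fracring S) (fracring T) frac_map
    frac_map_is_monoid_morphism.

Lemma frac_map_tofracring a :
  frac_map (tofracring S a) = tofracring T (i a).
Proof.
by rewrite /tofracring frac_mapE; apply: eq_frac; rewrite /= rmorph1.
Qed.

(** All primes are contracted to [A] and [B], where [i] goes down. The prime [q1] found there lies
    over a prime avoiding [S], so it avoids [T] and extends to the fractions. *)
Lemma going_down_frac_map : going_down i -> going_down frac_map.
Proof.
move=> GDi P1 P2 Q2 hP1 hP2 P12 hQ2 Q2P2.
have hp1 := preim_prime_ideal (tofracring S) hP1.
have hp2 := preim_prime_ideal (tofracring S) hP2.
have hq2 := preim_prime_ideal (tofracring T) hQ2.
have [||q1 [hq1 q12 q1p1]] := GDi _ _ _ hp1 hp2 _ hq2.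
- by move=> a; rewrite !inE => /P12.
- by move=> a; rewrite !inE -Q2P2 inE /= frac_map_tofracring.
have Tq1 b : b \in T -> b \notin q1.
  move=> /asboolP[s sS <-].
  have := prime_fracring_avoids hP1 sS.
  by rewrite -[i s \in q1]/(s \in [preim i of q1]) q1p1.
exists (loc_prime q1); split; first exact: loc_prime_prime.
- by apply: loc_prime_sub => // b /q12.
- move=> x; have [a [s ->]] := fracP x.
  rewrite inE /= frac_mapE mem_loc_prime // (prime_fracring_frac hP1).
  by rewrite -[i a \in q1]/(a \in [preim i of q1]) q1p1.
Qed.

Lemma overring_frac_map : {subset S <= @Reg A} ->
  overring_map i -> overring_map frac_map.
Proof.
move=> SR [iinj iR iden].
have TR : {subset T <= @Reg B} by move=> _ /asboolP[s /SR/iR sR <-].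
split.
- move=> x y; have [a [s ->]] := fracP x; have [b [t ->]] := fracP y.
  rewrite /= !frac_mapE => /eq_fracP[u /TR/RegP uR /= e]; apply: eq_frac.
  apply: iinj; apply/eqP; rewrite -subr_eq0 !rmorphM; apply/eqP/uR.
  by rewrite mulrBr e subrr.
- move=> x; have [a [s ->]] := fracP x => /(Reg_frac SR)/iR aR.
  rewrite /= frac_mapE; apply/RegP => y y0.
  have /RegP := tofracring_Reg T aR; apply.
  by rewrite -(tofracK _ (image_denom s)) -mulrA y0 mulr0.
- move=> x; have [b [[t tT] ->]] := fracP x.
  have [r rR [a ra]] := iden b; have /asboolP[s sS st] := tT.
  (* Here [x] = [b]/[t] with [t] = [i s]: the factor [s] removes the denominator and [r] then
     carries [b] into the image of [A]. *)
  exists (tofracring S (r * s)); first by apply/tofracring_Reg/rpredM/SR.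
  exists (tofracring S a); rewrite /= !frac_map_tofracring -ra !rmorphM st.
  by rewrite -mulrA; congr (_ * _); apply: (tofracK b (mkdenom tT)).
Qed.

(** * Tensor products and localization *)

Section LocalizedTensor.
Variable N : lmodType A.
Local Notation B_A := (restrict_scalars i).
Local Notation T_B := (restrict_scalars frac_map).
Local Notation BN := (tensor B_A N).

Let image_denomP (t : denom T) : {s : denom S | i (val s) = val t}.
Proof.
by apply: cid; have /asboolP[s sS st] := valP t; exists (mkdenom sS).
Qed.

(* The bilinear map T^-1 B x S^-1 N -> S^-1 (B (x) N). *)
Definition frac_tens (c : T_B) (x : fracmod S N) : fracmod S BN :=
  mfrac (tens ((repr (c : fracring T)).1 : B_A) (repr x).1)
    (denomM (sval (image_denomP (repr (c : fracring T)).2)) (repr x).2).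

(** Well-definedness: the value depends neither on the representatives nor on the element of [S]
    chosen above the denominator [t]. *)
Lemma frac_tensE (b : B) (t : denom T) (s : denom S) n u :
  i (val s) = val t ->
  frac_tens (frac b t) (mfrac n u) = mfrac (tens (b : B_A) n) (denomM s u).
Proof.
have : frac (repr (frac b t)).1 (repr (frac b t)).2 = frac b t.
  by rewrite /frac -surjective_pairing reprK.
have : mfrac (repr (mfrac n u)).1 (repr (mfrac n u)).2 = mfrac n u.
  by rewrite /mfrac -surjective_pairing reprK.
rewrite /frac_tens; case: (image_denomP _) => -[s' s'S] /=.
move: (repr (frac b t)) (repr (mfrac n u)) => [b' [t' t'T]] [n' [u' u'S]] /=.
case: s t u => [s sS] [t tT] [u uS] /=.
move=> st' /eq_mfracP[v vS /= nE] /eq_fracP[_ /asboolP[w wS <-] /= bE] st.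
apply/eq_mfracP; exists (w * v); rewrite /= ?rpredM //.
(* The factor witnessing equality in the localization of [B] is some [i w], so that equality is one
   between [A]-multiples and can move through the tensor sign. *)
have wb : (w * s) *: (b' : B_A) = (w * s') *: (b : B_A).
  rewrite -[LHS]/(i (w * s) * b') -[RHS]/(i (w * s') * b).
  by rewrite !rmorphM st st' -!mulrA [t * _]mulrC [t' * _]mulrC.
transitivity (tens ((w * s) *: (b' : B_A)) ((v * u) *: n')).
  by rewrite tensZl tensZr !scalerA; congr (_ *: _); ring.
have vn : (v * u) *: n' = (v * u') *: n by rewrite -!scalerA.
by rewrite wb vn tensZl !tensZr !scalerA; congr (_ *: _); ring.
Qed.

Lemma frac_tens_linearl x : linear (frac_tens^~ x).
Proof.
have [n [[u uS] ->]] := mfracP x.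
move=> a c d; have [e [[r rS] ->]] := fracP a.
have [b [[t tT] cE]] := fracP (c : fracring T).
have [b' [[t' t'T] dE]] := fracP (d : fracring T); rewrite {}cE {}dE.
have /asboolP[s sS st] := tT; have /asboolP[s' s'S st'] := t'T.
rewrite (@frac_tensE b _ (mkdenom sS)) // (@frac_tensE b' _ (mkdenom s'S)) //.
rewrite mfracZ mfracD.
rewrite -[frac e _ *: _ + _]/(frac_map (frac e (mkdenom rS)) *
  (frac b (mkdenom tT)) + frac b' (mkdenom t'T)) frac_mapE fracM fracD.
rewrite (@frac_tensE _ _
  (denomM (denomM (mkdenom rS) (mkdenom sS)) (mkdenom s'S))); last first.
  by rewrite /= !rmorphM st st'.
apply: eq_mfrac => /=.
(* Denominators from [T] are written as images of [s] and [s'], turning the numerator into an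
   [A]-combination on which [tens] is linear. *)
have -> : i e * b * t' + b' * (i r * t) =
  (e * s') *: (b : B_A) + (r * s) *: (b' : B_A).
  rewrite -[RHS]/(i (e * s') * b + i (r * s) * b') !rmorphM st st'.
  by ring.
rewrite tensDl !tensZl !scalerDr !scalerA.
by congr (_ *: _ + _ *: _); ring.
Qed.

Lemma frac_tens_linearr c : linear (frac_tens c).
Proof.
have [b [[t tT] cE]] := fracP (c : fracring T); rewrite {}cE.
have /asboolP[s sS st] := tT.
move=> a x y; have [e [[r rS] ->]] := fracP a.
have [n [[u uS] ->]] := mfracP x; have [n' [[u' u'S] ->]] := mfracP y.
rewrite mfracZ mfracD !(@frac_tensE b _ (mkdenom sS)) // mfracZ mfracD.
apply: eq_mfrac => /=.
rewrite tensDr !tensZr !scalerDr !scalerA.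
by congr (_ *: _ + _ *: _); ring.
Qed.

(** The bilinear map [frac_tens] sends the formal sum to [tens_sum s] over 1, which therefore
    vanishes; a fraction is zero only if some element of [S] kills its numerator. *)
Lemma tensor_rel_frac (s : seq (B_A * N)) :
  @tensor_rel (fracring S) T_B (fracmod S N)
    [seq (tofracring T p.1 : T_B, tofracmod S p.2) | p <- s] [::] ->
  exists2 u, u \in S & u *: tens_sum s = 0.
Proof.
move=> /(tensor_rel_bilinear frac_tens_linearl frac_tens_linearr).
rewrite big_nil big_map /= => e; apply: (@mfrac_eq0 _ _ _ _ (denom1 S)).
rewrite -[RHS]e tens_sumE.
have tD := @tofracmodD A S BN.
have t0 : tofracmod S (0 : BN) = 0 by [].
rewrite -[LHS]/(tofracmod S _) (big_morph _ tD t0).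
apply: eq_bigr => p _; rewrite /tofracring /tofracmod.
rewrite (@frac_tensE _ _ (denom1 S)) /= ?rmorph1 //.
by apply: eq_mfrac; rewrite /= mulr1.
Qed.

End LocalizedTensor.

(** The relation is localized, then pulled back along [fracmod_map f], which is still injective, by
    flatness of the localized overring; [tensor_rel_frac] supplies the multiplier. *)
Lemma flat_frac_map_kernel (N N' : lmodType A) (f : {linear N -> N'})
    (s : seq (restrict_scalars i * N)) :
  flat (restrict_scalars frac_map) -> injective f ->
  tensor_rel [seq (p.1, f p.2) | p <- s] [::] ->
  exists2 u, u \in S & u *: tens_sum s = 0.
Proof.
move=> /flatP Tflat finj.
pose B_A : lmodType A := restrict_scalars i.
pose T_B : lmodType (fracring S) := restrict_scalars frac_map.
pose tau : B_A -> T_B := tofracring T.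
have tauD : {morph tau : x y / x + y}.
  by move=> x y; apply: (rmorphD (tofracring T)).
have tauZ a x : tau (a *: x) = tofracring S a *: tau x.
  rewrite -[RHS]/(frac_map (tofracring S a) * tofracring T x).
  by rewrite frac_map_tofracring -rmorphM.
move=> /(@tensor_rel_semilinear _ _ (tofracring S) B_A N' T_B (fracmod S N')
  tau (@tofracmod _ S N') tauD tauZ (@tofracmodD _ _ _) (@tofracmodZ _ _ _)).
move=> h; apply: tensor_rel_frac.
apply: (Tflat _ _ (fracmod_map f : {linear fracmod S N -> fracmod S N'})).
  exact: fracmod_map_inj.
move: h; rewrite -!map_comp.
(* Naturality: localizing after [f] equals applying [fracmod_map f] after localizing. *)
have -> // :
  map ((fun p => (tau p.1, tofracmod S p.2)) \o (fun p => (p.1, f p.2))) s =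
  map ((fun p => (p.1, fracmod_map f p.2)) \o
    (fun p => (tofracring T p.1 : T_B, tofracmod S p.2))) s.
by apply: eq_map => p /=; rewrite fracmod_mapE.
Qed.

End ImageFractions.

(** * The local criterion for flatness and the equivalence *)

Lemma flat_local (A : comPzRingType) (M : lmodType A) :
  (forall (P : {pred A}) (hP : maximal_ideal P) (N N' : lmodType A)
      (f : {linear N -> N'}) (s : seq (M * N)), injective f ->
    tensor_rel [seq (p.1, f p.2) | p <- s] [::] ->
    exists2 u, u \notin P & u *: tens_sum s = 0) ->
  flat M.
Proof.
move=> H; apply/flatP => N N' f finj s h; apply/tens_sumP.
(* The annihilator of the kernel element: if proper, it lies in a maximal ideal [P], against the
   annihilating element outside [P] given by [H]. *)
pose I : {pred A} := fun u => `[< u *: tens_sum s = 0 >].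
have [/asboolP|I1] := boolP (1 \in I); first by rewrite scale1r.
have [|P hP IP] := @exists_maximal_ideal _ I _ I1.
  split=> [|a u v /asboolP uI /asboolP vI]; apply/asboolP.
    by rewrite scale0r.
  by rewrite scalerDl -scalerA uI vI scaler0 addr0.
have [u uP us] := H P hP _ _ _ _ finj h.
by case/negP: uP; apply: IP; apply/asboolP.
Qed.

Theorem proposition6 (A : comPzRingType) :
  perinormal A <->
  forall (M : {pred A}) (hM : maximal_ideal M),
    perinormal (regular_quotient_ring (maximal_prime hM)).
Proof.
have SR (M : {pred A}) (hM : prime_ideal M) :
  {subset Reg_compl hM <= @Reg A} by move=> a /andP[].
split=> [perA M hM|H]; first exact: perinormal_fracring (SR M _) perA.
apply/perinormalP => B i iov GDi; apply: flat_local => M hM N N' f s finj h.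
have /perinormalP perM := H M hM.
have Fflat := perM _ _ (overring_frac_map (SR M (maximal_prime hM)) iov)
  (going_down_frac_map GDi).
have [u /andP[uM _] us] := flat_frac_map_kernel Fflat finj h.
by exists u.
Qed.
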